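(* There exist infinitely many positive integers $n$ for which $\mathrm{pre}_3$ is not injective on the set of partitions of $n$ with length greater than $3$; that is, for infinitely many $n$ there exist distinct partitions $\lambda\neq\mu$ of $n$, each of length greater than $3$, with $\mathrm{pre}_3(\lambda)=\mathrm{pre}_3(\mu)$.
   Context: A partition $\lambda=(\lambda_1,\dots,\lambda_\ell)$ of $n$ is a nonincreasing sequence of positive integers summing to $n$; $\ell$ is its length. For a positive integer $k\le \ell$, $\mathrm{pre}_k(\lambda)$ is the partition whose parts (with multiplicity) are the summands of the elementary symmetric polynomial $e_k(\lambda_1,\dots,\lambda_\ell)=\sum_{1\le i_1<\cdots<i_k\le \ell}\lambda_{i_1}\cdots\lambda_{i_k}$, i.e. the multiset of all products $\lambda_{i_1}\cdots\lambda_{i_k}$ over index sets $1\le i_1<\cdots<i_k\le \ell$, sorted in nonincreasing order. *)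

(* Defs.v *)
From mathcomp Require Import all_boot.

Set Implicit Arguments.
Unset Strict Implicit.
Unset Printing Implicit Defensive.

Definition is_partition (n : nat) (lam : seq nat) : bool :=
  [&& sorted geq lam, all (leq 1) lam & sumn lam == n].

(* The index sets i_1 < ... < i_k are the k-element subsets of 'I_(size lam)
   (0-based positions in lam), so products are listed with multiplicity. *)
Definition pre (k : nat) (lam : seq nat) : seq nat :=
  sort geq
    [seq \prod_(i in A) nth 0 lam i
       | A : {set 'I_(size lam)} in [set A : {set 'I_(size lam)} | #|A| == k]].

(* Main.v *)
Require Import Defs.
From mathcomp Require Import all_boot zify.

Set Implicit Arguments.
Unset Strict Implicit.
Unset Printing Implicit Defensive.

(** Complementation is the whole idea.  Take [2k] positive integers
    [x_0, ..., x_(2k-1)] whose product is [C ^ k], each of them dividing [C],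
    and set [y_i = C / x_i].  For a [k]-subset [A] of the indices,
    [\prod_(i in A) y_i = C ^ k / \prod_(i in A) x_i] is the product of the
    [x_i] over the complement of [A], which is again a [k]-subset.  Hence the
    [x_i] and the [y_i] have the same multiset of [k]-fold products
    ([pre_codivisors]).

    For the [y_i] to be a partition of the same integer one also needs
    [\sum x_i = \sum y_i].  With [k = 3] and [C = 160] this happens for
    [32, 32, 10, 10, 10, 4], whose codivisors are [5, 5, 16, 16, 16, 40]:
    both sum to [98], and [32 ^ 2 * 10 ^ 3 * 4 = 160 ^ 3].  Multiplying all
    the parts by [c] keeps these relations, with [160 * c ^ 2] for [C], so one
    example yields one for every positive multiple of [98]. *)

(** The index type of [pre] mentions the sequence itself; a common index type
    is what makes two values of [pre] comparable. *)
Lemma pre_ord (k m : nat) (s : seq nat) : size s = m ->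
  pre k s = sort geq [seq \prod_(i in A) nth 0 s i
                       | A : {set 'I_m} in [set A : {set 'I_m} | #|A| == k]].
Proof. by move=> <-. Qed.

(** Passing from a sequence to its codivisors reverses the order, so
    nonincreasing sequences are paired by [rev_ord]; the bijection between
    [k]-subsets is reversal followed by complementation. *)
Lemma pre_codivisors (k C : nat) (s t : seq nat) :
  size s = k.*2 -> size t = k.*2 -> 0 < C ->
  (forall i : 'I_k.*2, nth 0 t i * nth 0 s (rev_ord i) = C) ->
  \prod_(i < k.*2) nth 0 s i = C ^ k ->
  pre k s = pre k t.
Proof.
move=> size_s size_t C_gt0 st_C prod_s.
rewrite (pre_ord k size_s) (pre_ord k size_t).
have geq_total : total geq by move=> x y; exact: leq_total.
have geq_trans : transitive geq by move=> y x z /= yx zy; exact: leq_trans yx.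
have geq_anti : antisymmetric geq.
  by move=> x y /andP[yx xy]; apply/eqP; rewrite eqn_leq; apply/andP.
apply/(perm_sortP geq_total geq_trans geq_anti).
pose f (A : {set 'I_k.*2}) := ~: (@rev_ord k.*2 @: A).
have f_inj : injective f.
  by move=> A B /setC_inj; apply: imset_inj; exact: rev_ord_inj.
have card_f (A : {set 'I_k.*2}) : #|A| = k -> #|f A| = k.
  move=> cardA; have := cardsC (@rev_ord k.*2 @: A).
  rewrite card_imset ?cardA; last exact: rev_ord_inj.
  by rewrite card_ord /f; lia.
have prod_f (A : {set 'I_k.*2}) : #|A| = k ->
    \prod_(i in A) nth 0 t i = \prod_(i in f A) nth 0 s i.
  move=> cardA.
  have prodC : (\prod_(i in A) nth 0 t i) *
               (\prod_(i in @rev_ord k.*2 @: A) nth 0 s i) = C ^ k.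
    rewrite big_imset /=; last by move=> x y _ _; exact: rev_ord_inj.
    rewrite -big_split /= (eq_bigr (fun=> C)) => [|i _]; last exact: st_C.
    by rewrite prod_nat_const cardA.
  have prodCs : (\prod_(i in f A) nth 0 s i) *
                (\prod_(i in @rev_ord k.*2 @: A) nth 0 s i) = C ^ k.
    rewrite mulnC -prod_s [RHS](bigID (mem (@rev_ord k.*2 @: A))) /=.
    by congr (_ * _); apply: eq_bigl => i; rewrite inE.
  (* The common factor divides the positive number C ^ k. *)
  pose m := \prod_(i in @rev_ord k.*2 @: A) nth 0 s i.
  apply/eqP; rewrite -(eqn_pmul2r (m := m)) /m.
    by rewrite prodC prodCs.
  have : 0 < C ^ k by rewrite expn_gt0 C_gt0.
  by rewrite -prodC muln_gt0 => /andP[].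
set K := [set A | _].
(* An injection of the finite set K into itself permutes it. *)
have permK : perm_eq (enum K) (map f (enum K)).
  have sub : {subset map f (enum K) <= enum K}.
    move=> B /mapP[A]; rewrite mem_enum inE => /eqP cardA ->.
    by rewrite mem_enum inE card_f.
  have uniq_f : uniq (map f (enum K)) by rewrite map_inj_uniq ?enum_uniq.
  apply: uniq_perm; rewrite ?enum_uniq // => A.
  have [_ ->] := uniq_min_size uniq_f sub (eq_leq (esym (size_map f _))).
  by [].
rewrite /image_mem.
have -> : [seq \prod_(i in A) nth 0 t i | A : {set 'I_k.*2} <- enum K] =
          [seq \prod_(i in A) nth 0 s i | A : {set 'I_k.*2} <- map f (enum K)].
  rewrite -map_comp; apply/eq_in_map => A.
  by rewrite mem_enum inE => /eqP /prod_f.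
exact: perm_map.
Qed.

Theorem theorem1p3 :
  forall N : nat, exists n : nat, N < n /\
    exists lam mu : seq nat,
      [/\ is_partition n lam, is_partition n mu,
          3 < size lam, 3 < size mu & lam <> mu /\ pre 3 lam = pre 3 mu].
Proof.
move=> N; pose c := N.+1; exists (98 * c); split; first by rewrite /c; lia.
exists [:: 32 * c; 32 * c; 10 * c; 10 * c; 10 * c; 4 * c].
exists [:: 40 * c; 16 * c; 16 * c; 16 * c; 5 * c; 5 * c].
split=> //; try by rewrite /is_partition /= /c; lia.
split; first by case; rewrite /c; lia.
apply: (@pre_codivisors 3 (160 * c ^ 2)) => //.
- by case=> [[|[|[|[|[|[|i]]]]]] lti] //=; lia.
- by rewrite !big_ord_recl big_ord0 /=; lia.
Qed.
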